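(* Let $X$ be a topological space and let $(Y,d)$ be a complete metric space. Then $C_w(X,Y)$ is strongly $\alpha$-favorable.
   Context: $C(X,Y)$ is the set of all continuous functions $f:X\to Y$, and $C^+(X)$ is the set of strictly positive continuous real-valued functions on $X$. For $f\in C(X,Y)$ and $\varepsilon:X\to(0,\infty)$ put $B(f,\varepsilon)=\{g\in C(X,Y): d(f(x),g(x))<\varepsilon(x)\ \text{for all}\ x\in X\}$. The fine topology $\tau_w$ on $C(X,Y)$ is the topology with base $\{B(f,\varepsilon): f\in C(X,Y),\ \varepsilon\in C^+(X)\}$; $C_w(X,Y)$ denotes $(C(X,Y),\tau_w)$. Strong Choquet game $Ch(Z)$: let $Z$ be a topological space with an open base $\mathcal B$, and let $\mathcal E=\{(z,V)\in Z\times\mathcal B: z\in V\}$. Players $\beta$ and $\alpha$ alternate. $\beta$ starts by picking $(z_0,V_0)\in\mathcal E$, and $\alpha$ responds with $U_0\in\mathcal B$ such that $z_0\in U_0\subseteq V_0$. At each later step $\beta$ picks $(z_{n+1},V_{n+1})\in\mathcal E$ with $V_{n+1}\subseteq U_n$, and $\alpha$ responds with $U_{n+1}\in\mathcal B$ such that $z_{n+1}\in U_{n+1}\subseteq V_{n+1}$. Player $\alpha$ wins the run if $\bigcap_n U_n=\bigcap_n V_n\neq\emptyset$; otherwise $\beta$ wins. $Z$ is strongly $\alpha$-favorable if $\alpha$ has a winning tactic in $Ch(Z)$, i.e. a function $t:\mathcal E\to\mathcal B$ such that $\alpha$ wins every run of the game with $U_n=t(z_n,V_n)$ for all $n$. 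*)

(* Defs.v *)
From HB Require Import structures.
From mathcomp Require Import all_boot all_order all_algebra.
From mathcomp Require Import all_classical all_reals topology normedtype.

Set Implicit Arguments.
Unset Strict Implicit.
Unset Printing Implicit Defensive.

Import Order.TTheory GRing.Theory Num.Theory.
Import numFieldNormedType.Exports.
Local Open Scope classical_set_scope.
Local Open Scope ring_scope.

(* The library's [completeType] is pointed; this hypothesis on a [metricType]
   does not force Y to be nonempty. *)
Definition complete_metric (R : realType) (Y : metricType R) : Prop :=
  forall u : nat -> Y, cauchy (u @ \oo) -> exists l : Y, u @ \oo --> l.

Section FineTopology.
Context {R : realType} {X : topologicalType} {Y : metricType R}.
Implicit Types (f g : continuousType X Y) (eps : continuousType X R).

Definition fine_ball f eps : set (continuousType X Y) :=
  [set g | forall x, mdist (f x) (g x) < eps x].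

Definition fine_base : set (set (continuousType X Y)) :=
  [set B | exists f eps, (forall x, 0 < eps x) /\ B = fine_ball f eps].

Lemma mdist_continuous f g : continuous (fun x => mdist (f x) (g x) : R).
Proof.
move=> x; apply/cvgrPdist_lt => e e0.
have e20 : 0 < e / 2 by rewrite divr_gt0.
have hf : \forall t \near x, mdist (f x) (f t) < e / 2.
  have := @cts_fun _ _ f x => /(_ _ (nbhsx_ballx (f x) _ e20)).
  by rewrite ballEmdist.
have hg : \forall t \near x, mdist (g x) (g t) < e / 2.
  have := @cts_fun _ _ g x => /(_ _ (nbhsx_ballx (g x) _ e20)).
  by rewrite ballEmdist.
near=> t.
have hft : mdist (f x) (f t) < e / 2 by near: t.
have hgt : mdist (g x) (g t) < e / 2 by near: t.
have h1 := metric_triangle (f x) (f t) (g x).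
have h2 := metric_triangle (f t) (g t) (g x).
have h3 := metric_triangle (f t) (f x) (g t).
have h4 := metric_triangle (f x) (g x) (g t).
rewrite (metric_sym (g t)) in h2; rewrite (metric_sym (f t) (f x)) in h3.
rewrite ltr_distl; apply/andP; split.
  rewrite ltrBlDr; apply: (le_lt_trans h3); rewrite addrC.
  apply: (le_lt_trans (lerD h4 (lexx _))).
  by rewrite -addrA ltrD2l [e]splitr ltrD.
apply: (le_lt_trans h1); rewrite addrC.
apply: (le_lt_trans (lerD h2 (lexx _))).
by rewrite -addrA ltrD2l [e]splitr ltrD.
Unshelve. all: by end_near. Qed.

Lemma fine_base_cover : \bigcup_(B in fine_base) id B = setT.
Proof.
apply/seteqP; split=> // f _.
exists (fine_ball f (cst 1)) => [|x]; last by rewrite mdistxx ltr01.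
by exists f, (cst 1); split=> // x; rewrite ltr01.
Qed.

Lemma fine_base_join (B1 B2 : set (continuousType X Y)) g :
  fine_base B1 -> fine_base B2 -> id B1 g -> id B2 g ->
  exists B, [/\ fine_base B, id B g & id B `<=` id B1 `&` id B2].
Proof.
move=> [f1 [e1 [e1_gt0 ->]]] [f2 [e2 [e2_gt0 ->]]] /= g1 g2.
pose h x : R := Order.min (e1 x - mdist (f1 x) (g x)) (e2 x - mdist (f2 x) (g x)).
have h_cts : continuous h.
  move=> x; apply: (@continuous_min _ _ (fun x => e1 x - mdist (f1 x) (g x))
      (fun x => e2 x - mdist (f2 x) (g x))).
    by apply: cvgB; [exact: cts_fun|exact: mdist_continuous].
  by apply: cvgB; [exact: cts_fun|exact: mdist_continuous].
have h_gt0 x : 0 < h x by rewrite /h lt_min !subr_gt0 g1 g2.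
exists (fine_ball g (mkcts h_cts)); split.
- by exists g, (mkcts h_cts).
- by move=> x /=; rewrite mdistxx; exact: h_gt0.
- move=> k /= gk; split=> x.
    have := gk x; rewrite /mkcts /h lt_min !ltrBrDl => /andP[+ _].
    exact/le_lt_trans/metric_triangle.
  have := gk x; rewrite /mkcts /h lt_min !ltrBrDl => /andP[_].
  exact/le_lt_trans/metric_triangle.
Qed.

End FineTopology.
Arguments fine_base {R} X Y.

(* An alias of [continuousType X Y], to which the library attaches other topologies. *)
Definition fine_space (R : realType) (X : topologicalType) (Y : metricType R) :=
  continuousType X Y.

HB.instance Definition _ (R : realType) (X : topologicalType)
    (Y : metricType R) := Choice.on (fine_space X Y).
HB.instance Definition _ (R : realType) (X : topologicalType)
    (Y : metricType R) := isBaseTopological.Build (fine_space X Y)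
  (@fine_base_cover R X Y) (@fine_base_join R X Y).

Lemma fine_base_basis (R : realType) (X : topologicalType) (Y : metricType R) :
  @basis (fine_space X Y) (fine_base X Y).
Proof.
split=> [A fA|f A].
  by exists [set A] => [B ->//|]; rewrite bigcup_set1.
rewrite nbhsE => -[B [[D' D'b <-] [C D'C Cf]] BA].
exists C => [|g Cg]; first by split=> //; exact: D'b.
by apply: BA; exists C.
Qed.

Section StrongChoquet.
Context {Z : topologicalType}.
Implicit Types (B : set (set Z)) (z : nat -> Z) (U V : nat -> set Z).

Definition choquet_pairs B : set (Z * set Z) := [set p | B p.2 /\ p.2 p.1].

Definition choquet_reply B (p : Z * set Z) (U : set Z) : Prop :=
  [/\ B U, U p.1 & U `<=` p.2].

Definition choquet_run B z V U : Prop :=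
  [/\ forall n, choquet_pairs B (z n, V n),
      forall n, choquet_reply B (z n, V n) (U n)
    & forall n, V n.+1 `<=` U n].

Definition alpha_wins V U : Prop :=
  \bigcap_n U n = \bigcap_n V n /\ \bigcap_n V n !=set0.

(* A tactic choquet_pairs B -> B is a total function, constrained only on pairs. *)
Definition winning_tactic B (t : Z * set Z -> set Z) : Prop :=
  (forall p, choquet_pairs B p -> choquet_reply B p (t p)) /\
  (forall z V U, choquet_run B z V U -> (forall n, U n = t (z n, V n)) ->
     alpha_wins V U).

End StrongChoquet.

(* The game is played with an open base of Z; which one is immaterial (a tactic
   for one base yields a tactic for any other), and all of them are required. *)
Definition strongly_alpha_favorable (Z : topologicalType) : Prop :=
  forall B : set (set Z), basis B -> exists t, winning_tactic B t.

(* Main.v *)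
Require Import Defs.
From mathcomp Require Import all_boot all_order all_algebra.
From mathcomp Require Import all_classical all_reals topology normedtype.
From mathcomp Require Import sequences lra.

(** The reply to [(f, V)] is taken inside a fine ball about [f] that is half as
    wide as one contained in [V], and so thin that the uniform oscillation
    [sup_x diam {g x | g in V}] is at least halved. The oscillation is a single
    number, so this only asks for a constant upper bound on the radius: if some
    [g] in [V] has [a = d(f x0, g x0) > 0], radius [a / 4] suffices, and
    otherwise the oscillation of [V] is already [0]. Along a run the functions
    chosen by beta are therefore uniformly Cauchy, their limit is continuous,
    and as it stays within half the radius of the ball contained in [V_n], it
    belongs to every [V_n]. *)

Set Implicit Arguments.
Unset Strict Implicit.
Unset Printing Implicit Defensive.

Import Order.TTheory GRing.Theory Num.Theory.
Import numFieldNormedType.Exports.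
Local Open Scope classical_set_scope.
Local Open Scope ring_scope.

Section MetricLimits.
Context {R : realType} {Y : metricType R}.

Lemma mdist_limit_le (u : nat -> Y) (l y : Y) (c : R) (n : nat) :
  u @ \oo --> l -> (forall m, (n <= m)%N -> mdist y (u m) <= c) ->
  mdist y l <= c.
Proof.
move=> ul yu; apply/ler_addgt0Pl => e e0.
have near_l : \forall m \near \oo, mdist l (u m) < e.
  by have := ul _ (nbhsx_ballx l _ e0); rewrite ballEmdist.
have [N _ Nl] := near_l.
have lu := Nl _ (leq_maxr n N); have yun := yu _ (leq_maxl n N).
have := metric_triangle y (u (maxn n N)) l.
rewrite (metric_sym (u _) l); lra.
Qed.

Lemma cauchy_mdist (u : nat -> Y) (c : nat -> R) :
  (forall n m, (n <= m)%N -> mdist (u n) (u m) <= c n) -> c @ \oo --> 0 ->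
  cauchy (u @ \oo).
Proof.
move=> uc c0; apply: cauchy_exP => e e0.
have /cvgrPdist_lt/(_ _ e0)[N _ Nc] := c0.
exists (u N); exists N => // m /= Nm; rewrite ballEmdist /=.
apply: le_lt_trans (uc _ _ Nm) _.
by have := Nc _ (leqnn N); rewrite /= sub0r normrN => /(le_lt_trans (ler_norm _)).
Qed.

End MetricLimits.

Section FineTactic.
Context {R : realType} {X : topologicalType} {Y : metricType R}.
Implicit Types (f g : fine_space X Y) (U V : set (fine_space X Y)).

Lemma continuous_uniform_limit (z : nat -> fine_space X Y) (F : X -> Y)
    (c : nat -> R) :
  (forall n x, mdist (z n x) (F x) <= c n) -> c @ \oo --> 0 -> continuous F.
Proof.
move=> zF c0 x; apply/cvg_ballP => e e0.
have e3 : 0 < e / 3 by rewrite divr_gt0.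
have /cvgrPdist_lt/(_ _ e3)[N _ Nc] := c0.
have cN : c N < e / 3.
  by have := Nc _ (leqnn N); rewrite /= sub0r normrN => /(le_lt_trans (ler_norm _)).
have zx : \forall t \near x, mdist (z N x) (z N t) < e / 3.
  have := @cts_fun _ _ (z N) x => /(_ _ (nbhsx_ballx (z N x) _ e3)).
  by rewrite ballEmdist.
near=> t; rewrite ballEmdist /=.
have zxt : mdist (z N x) (z N t) < e / 3 by near: t.
have h1 := metric_triangle (F x) (z N x) (F t).
have h2 := metric_triangle (z N x) (z N t) (F t).
have h3 := zF N x; have h4 := zF N t.
rewrite (metric_sym (F x) (z N x)) in h1; lra.
Unshelve. all: by end_near. Qed.

Lemma fine_ball_nbhs f (eps : continuousType X R) :
  (forall x, 0 < eps x) -> nbhs f (fine_ball f eps : set (fine_space X Y)).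
Proof.
move=> eps0; apply: open_nbhs_nbhs; split.
  have [base_open _] := fine_base_basis X Y.
  by apply: base_open; exists f, eps.
by move=> x; rewrite mdistxx.
Qed.

(** A basic ball around [f] may be centred at another function [f1]. By the triangle inequality it
    contains the ball about [f] with radius [e1 - d(f1, f)], which is continuous, and positive since
    [f] lies in the first ball. *)
Lemma nbhs_fine_ball f V : nbhs f V ->
  exists eps : continuousType X R, (forall x, 0 < eps x) /\
    fine_ball f eps `<=` V.
Proof.
have [_ base_nbhs] := fine_base_basis X Y.
move=> /base_nbhs[_ [[f1 [e1 [_ ->]]] f1f] sV].
have cts : continuous (fun x => e1 x - mdist (f1 x) (f x)).
  by move=> x; apply: cvgB; [exact: cts_fun|exact: mdist_continuous].
exists (mkcts cts); split=> [x|g fg]; first by rewrite subr_gt0; exact: f1f.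
apply: sV => x; have := fg x; rewrite /mkcts ltrBrDl.
exact/le_lt_trans/metric_triangle.
Qed.

(** Encoded through upper bounds because the supremum may be infinite. *)
Definition oscillation_le V (c : R) :=
  forall g h, V g -> V h -> forall x, mdist (g x) (h x) <= c.

(** The bound by [eps x / 2] is non-strict so that it survives pointwise limits. The bound [1]
    starts the halving, which says nothing while [V] has infinite oscillation. *)
Definition shrinking_reply f V U :=
  [/\ exists eps : continuousType X R, [/\ forall x, 0 < eps x,
        fine_ball f eps `<=` V &
        forall g, U g -> forall x, mdist (f x) (g x) <= eps x / 2],
      oscillation_le U 1
    & forall c, oscillation_le V c -> oscillation_le U (c / 2)].

Lemma oscillation_half_radius f V : V f -> exists r : R, [/\ 0 < r, r <= 1 / 2 &
  forall U, (forall g, U g -> V g /\ forall x, mdist (f x) (g x) <= r) ->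
    forall c, oscillation_le V c -> oscillation_le U (c / 2)].
Proof.
move=> Vf.
have [[g [x [Vg fg]]]|none] :=
    pselect (exists g x, V g /\ 0 < mdist (f x) (g x)).
  (* With [a = d(f x, g x)], every oscillation bound [c] of [V] is at least [a], while two members
     of [U] are at most [2 * (a / 4) <= c / 2] apart. The cap [1 / 2] later yields oscillation at
     most [1]. *)
  exists (Order.min (mdist (f x) (g x) / 4) (1 / 2)); split.
  - by rewrite lt_min; apply/andP; split; lra.
  - by rewrite ge_min lexx orbT.
  move=> U UV c Vc h k /UV[_ fh] /UV[_ fk] y.
  have := fh y; have := fk y; rewrite !le_min => /andP[fky _] /andP[fhy _].
  have := Vc _ _ Vf Vg x; have := metric_triangle (h y) (f y) (k y).
  rewrite (metric_sym (h y) (f y)); lra.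
have V0 h y : V h -> mdist (f y) (h y) <= 0.
  by move=> Vh; rewrite leNgt; apply/negP => fh; apply: none; exists h, y.
(* Here all members of [V] agree with [f] pointwise, so any radius works; comparing [f] with itself
   at [y] gives [0 <= c]. *)
exists (1 / 2); split; [by rewrite divr_gt0|exact: lexx|].
move=> U UV c Vc h k /UV[Vh _] /UV[Vk _] y.
have := V0 _ y Vh; have := V0 _ y Vk; have := Vc _ _ Vf Vf y.
have := metric_triangle (h y) (f y) (k y).
rewrite (metric_sym (h y) (f y)) mdistxx; lra.
Qed.

Lemma shrinking_reply_exists (B : set (set (fine_space X Y))) f V :
  basis B -> choquet_pairs B (f, V) ->
  exists U, choquet_reply B (f, V) U /\ shrinking_reply f V U.
Proof.
move=> [Bopen Bnbhs] [/= BV Vf].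
have [eps [eps0 epsV]] : exists eps : continuousType X R,
    (forall x, 0 < eps x) /\ fine_ball f eps `<=` V.
  by apply: nbhs_fine_ball; apply: open_nbhs_nbhs; split=> //; exact: Bopen.
have [r [r0 r2 Vr]] := oscillation_half_radius Vf.
have cts : continuous (fun x => Order.min (eps x / 2) r).
  move=> x; apply: (@continuous_min _ _ (fun x => eps x / 2) (fun=> r)).
    by apply: cvgMl; exact: cts_fun.
  exact: cvg_cst.
have ball_nbhs : nbhs f (fine_ball f (mkcts cts) : set (fine_space X Y)).
  apply: fine_ball_nbhs => x; rewrite /mkcts lt_min r0 andbT.
  by rewrite divr_gt0.
(* The base [B] is arbitrary, so [U] need not be a ball; it only inherits the estimates of the ball
   around it. *)
have [U [BU Uf] Uball] := Bnbhs f _ ball_nbhs.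
have Ueps g x : U g -> mdist (f x) (g x) <= eps x / 2 /\ mdist (f x) (g x) <= r.
  by move=> /Uball/(_ x)/ltW; rewrite /mkcts le_min => /andP.
have UV : U `<=` V.
  move=> g Ug; apply: epsV => x.
  have [gx _] := Ueps _ x Ug; have := eps0 x; lra.
exists U; split=> //; split.
- by exists eps; split=> // g Ug x; have [] := Ueps _ x Ug.
- move=> g h Ug Uh x; have [_ gx] := Ueps _ x Ug; have [_ hx] := Ueps _ x Uh.
  have := metric_triangle (g x) (f x) (h x).
  rewrite (metric_sym (g x) (f x)); lra.
- by apply: Vr => g Ug; split=> [|x]; [exact: UV|have [] := Ueps _ x Ug].
Qed.

Lemma shrinking_run_nonempty (B : set (set (fine_space X Y)))
    (z : nat -> fine_space X Y) (V U : nat -> set (fine_space X Y)) :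
  complete_metric Y -> choquet_run B z V U ->
  (forall n, shrinking_reply (z n) (V n) (U n)) -> \bigcap_n V n !=set0.
Proof.
move=> Y_complete [zV Ureply VU] shrink.
have UleV n : U n `<=` V n by have [] := Ureply n.
have Umono n m : (n <= m)%N -> U m `<=` U n.
  elim: m => [|m IH]; first by rewrite leqn0 => /eqP ->.
  rewrite leq_eqVlt => /predU1P[->//|/IH mn].
  by apply: subset_trans mn; apply: subset_trans (VU m); exact: UleV.
have zU n m : (n <= m)%N -> U n (z m).
  by move=> nm; apply: Umono nm _ _; have [] := Ureply m.
pose c n : R := 2^-1 ^+ n.
(* Bounds pass from [U n] to [V n.+1] by inclusion, and are halved in [U n.+1]. *)
have osc n : oscillation_le (U n) (c n).
  elim: n => [|n IH]; first by have [_ + _] := shrink 0%N; rewrite /c expr0.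
  have [_ _ half] := shrink n.+1; rewrite /c exprSr; apply: half.
  by move=> g h /VU Ug /VU Uh; exact: IH.
have c0 : c @ \oo --> 0.
  by apply: cvg_expr; rewrite ger0_norm ?invr_ge0// invf_lt1// ltr1n.
have zz x n m : (n <= m)%N -> mdist (z n x) (z m x) <= c n.
  by move=> nm; apply: osc; exact: zU.
have lims x : exists l : Y, (fun n => z n x) @ \oo --> l.
  by apply: Y_complete; apply: cauchy_mdist c0; exact: zz.
have [F zF] := choice lims.
have Fcts : continuous F.
  apply: (@continuous_uniform_limit z F c) => // n x.
  by apply: (mdist_limit_le (zF x)); exact: zz.
exists (mkcts Fcts) => n _.
have [[eps [eps0 epsV epsU]] _ _] := shrink n.
apply: epsV => x.
(* All [z m] with [m >= n] lie in [U n], so the half-radius bound passes to the limit; [eps x > 0]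
   then makes it strict. *)
have : mdist (z n x) (F x) <= eps x / 2.
  apply: (mdist_limit_le (n := n) (zF x)) => m nm.
  by apply: epsU; exact: zU.
have := eps0 x; rewrite /mkcts; lra.
Qed.

End FineTactic.

Lemma choquet_run_bigcap (Z : topologicalType) (B : set (set Z))
    (z : nat -> Z) (V U : nat -> set Z) :
  choquet_run B z V U -> \bigcap_n U n = \bigcap_n V n.
Proof.
move=> [_ Ureply VU]; apply/seteqP; split=> g Hg n _.
  by have [_ _] := Ureply n; apply; exact: Hg.
by apply: VU; exact: Hg.
Qed.

Theorem theorem3p2 (R : realType) (X : topologicalType) (Y : metricType R)
  (Y_complete : complete_metric Y) :
  strongly_alpha_favorable (fine_space X Y).
Proof.
move=> B Bbasis.
have reply (p : fine_space X Y * set (fine_space X Y)) :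
    exists U, choquet_pairs B p ->
      choquet_reply B p U /\ shrinking_reply p.1 p.2 U.
  (* The value [set0] is a dummy off the legal pairs, making the tactic total. *)
  have [Bp|] := pselect (choquet_pairs B p); last by exists set0.
  case: p Bp => f V Bp.
  by have [U HU] := shrinking_reply_exists Bbasis Bp; exists U.
have [t tP] := choice reply.
exists t; split=> [p /tP[]//|z V U run Ut]; split.
  exact: choquet_run_bigcap run.
apply: shrinking_run_nonempty (run) _ => // n.
by have [zV _ _] := run; rewrite Ut; have [] := tP _ (zV n).
Qed.
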